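(* Let $P$ be a real polynomial on $\mathbb{R}^n$ which contains a monomial term $k x^p$ with coefficient $k<0$ and exponent $p\in\mathbb{N}_0^n$, such that $p$ is not the sum of any two distinct lattice points (points of $\mathbb{Z}^n$) in $\tfrac12 C_P$. Then $P$ is not a sum of squares of polynomials.
   Context: If $P(x)=c_1x^{q_1}+\cdots+c_mx^{q_m}$ with $c_j\ne 0$ and distinct $q_j\in\mathbb{N}_0^n$ (multi-index notation), the Newton polytope $C_P$ is the convex hull in $\mathbb{R}^n$ of the points $q_1,\dots,q_m$. The dilate is $\tfrac12C_P=\{\tfrac12x: x\in C_P\}$. Sums of squares are finite sums of squares of real polynomials. *)

(* Defs.v *)
From HB Require Import structures.
From mathcomp Require Import all_boot all_order all_algebra.
From mathcomp Require Import classical_sets reals.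
From mathcomp Require Import mpoly.

Set Implicit Arguments.
Unset Strict Implicit.
Unset Printing Implicit Defensive.

Import Order.TTheory GRing.Theory Num.Theory.

Local Open Scope classical_set_scope.
Local Open Scope ring_scope.

Definition convex_hull (R : numDomainType) (E : lmodType R) (s : seq E) : set E :=
  [set x | exists w : 'I_(size s) -> R,
     [/\ forall i, 0 <= w i,
         \sum_(i < size s) w i = 1
       & x = \sum_(i < size s) w i *: s`_i]].

Definition exponent_point (R : realType) (n : nat) (m : 'X_{1..n}) : 'rV[R]_n :=
  \row_(i < n) (m i)%:R.

Definition newton_polytope (R : realType) (n : nat) (P : {mpoly R[n]}) :
    set 'rV[R]_n :=
  convex_hull [seq exponent_point R m | m <- msupp P].

Definition half_newton_polytope (R : realType) (n : nat) (P : {mpoly R[n]}) :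
    set 'rV[R]_n :=
  [set 2^-1 *: x | x in newton_polytope P].

Definition lattice_point (R : realType) (n : nat) (x : 'rV[R]_n) : Prop :=
  forall i : 'I_n, x ord0 i \is a Num.int.

Definition sum_of_squares (R : realType) (n : nat) (P : {mpoly R[n]}) : Prop :=
  exists s : seq {mpoly R[n]}, P = \sum_(q <- s) q ^+ 2.

(* Main.v *)
(* Let P be the sum of the squares of the q's, let S be the set of all exponents
   of the q's, and discard from S one point at a time while the convex hull
   still contains S. When this stops, no remaining point v is the midpoint of
   two distinct points of S, so the coefficient of P at 2v is the sum of the
   squares of the coefficients of the q's at v, hence positive. Thus 2v lies in
   C_P, and S lies in C_P / 2. A negative coefficient at p requires a cross
   term, i.e. p = a + b with a <> b in S. *)
Require Import Defs.
From mathcomp Require Import all_boot all_order all_algebra.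
From mathcomp Require Import classical_sets reals.
From mathcomp Require Import ring lra.
From mathcomp Require Import mpoly.

Import Order.TTheory GRing.Theory Num.Theory.

Local Open Scope ring_scope.

Section ConvexHull.
Set Implicit Arguments.
Unset Strict Implicit.

Variables (R : realFieldType) (E : lmodType R).
Implicit Types (s t : seq E) (x y v : E) (C : set E).

Definition convex_set C := forall x y (l : R),
  0 <= l -> l <= 1 -> C x -> C y -> C (l *: x + (1 - l) *: y).

Lemma convex_hull_convex s : convex_set (convex_hull s).
Proof.
move=> x y l l0 l1 [w [w0 w1 ->]] [w' [w'0 w'1 ->]].
exists (fun i => l * w i + (1 - l) * w' i); split.
- by move=> i; rewrite addr_ge0 ?mulr_ge0 ?subr_ge0.
- by rewrite big_split /= -!mulr_sumr w1 w'1 !mulr1 addrC subrK.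
- rewrite !scaler_sumr -big_split /=; apply: eq_bigr => i _.
  by rewrite !scalerA -scalerDl.
Qed.

Lemma mem_convex_hull s x : x \in s -> convex_hull s x.
Proof.
move=> xs; have ltx : (index x s < size s)%N by rewrite index_mem.
pose i0 := Ordinal ltx.
exists (fun i => (i == i0)%:R); split.
- by move=> i; rewrite ler0n.
- rewrite (bigD1 i0) //= eqxx big1 ?addr0 // => i /negPf -> //.
- rewrite (bigD1 i0) //= eqxx scale1r nth_index // big1 ?addr0 // => i /negPf ->.
  by rewrite scale0r.
Qed.

(** The weight [l] of [v] is split off and the remaining weights are divided by their sum [1 - l].
    When [l = 1] this division is impossible, but then the other weights are nonnegative with sum 0,
    hence all vanish. *)
Lemma convex_hull_cons v t x : convex_hull (v :: t) x ->
  x = v \/ exists l y,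
    [/\ 0 <= l, l < 1, convex_hull t y & x = l *: v + (1 - l) *: y].
Proof.
move=> [w [w0]]; rewrite /= !big_ord_recl /= => w1 ->.
set l := w ord0 in w1 *; set w' := fun i : 'I_(size t) => w (lift ord0 i).
have {w1}w1 : \sum_(i < size t) w' i = 1 - l by rewrite -w1 addrC addKr.
have : 0 <= 1 - l by rewrite -w1 sumr_ge0 // => i _; exact: (w0 (lift ord0 i)).
rewrite le_eqVlt => /orP[/eqP l1|l1]; [left|right].
- have w'0 i : w' i = 0.
    apply/eqP; have /eqP := w1; rewrite -l1 psumr_eq0 => [|j _];
      last exact: (w0 (lift ord0 j)).
    by move=> /allP/(_ i); rewrite mem_index_enum => /(_ isT).
  rewrite big1 => [|i _]; last by rewrite -/(w' i) w'0 scale0r.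
  by rewrite addr0 (_ : l = 1) ?scale1r //; lra.
- have nz : 1 - l != 0 by rewrite gt_eqF.
  exists l, (\sum_(i < size t) (w' i / (1 - l)) *: t`_i); split.
  + exact: (w0 ord0).
  + by rewrite -subr_gt0.
  + exists (fun i => w' i / (1 - l)); split=> //.
      by move=> i; apply: divr_ge0; [exact: (w0 (lift ord0 i)) | exact: ltW].
    by rewrite -mulr_suml w1 divff.
  + congr (_ + _); rewrite scaler_sumr; apply: eq_bigr => i _.
    by rewrite scalerA mulrCA divff // mulr1.
Qed.

Lemma convex_hull_min s C : convex_set C -> (forall x, x \in s -> C x) ->
  forall x, convex_hull s x -> C x.
Proof.
move=> cC; elim: s => [|v t IH] sC x.
  (* The hull of the empty list is empty, since an empty sum of weights cannot be 1. *)
  by move=> [w [_ /eqP]]; rewrite big_ord0 eq_sym oner_eq0.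
move=> /convex_hull_cons[->|[l [y [l0 l1 ty ->]]]].
  by apply: sC; rewrite mem_head.
apply: cC => //; [exact: ltW | by apply: sC; rewrite mem_head |].
by apply: IH => // z zt; apply: sC; rewrite inE zt orbT.
Qed.

(** Write [a = k *: v + (1 - k) *: x] and [b = l *: v + (1 - l) *: y] with [x], [y] in the hull of
    [t]. Cancelling [v] in [a + b = v + v] leaves [(2 - k - l) *: v = (1 - k) *: x + (1 - l) *: y],
    and [k, l < 1] allows division. If [a] or [b] is [v] itself, the two coincide. *)
Lemma midpoint_convex_hull v t a b : convex_hull (v :: t) a ->
  convex_hull (v :: t) b -> a + b = v + v -> a <> b -> convex_hull t v.
Proof.
have half x y : v + v = x + y -> v = 2^-1 *: x + (1 - 2^-1) *: y.
  have -> : 1 - 2^-1 = 2^-1 :> R by lra.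
  rewrite -scalerDr => <-; rewrite -mulr2n -scaler_nat scalerA mulVf ?scale1r //.
  by rewrite pnatr_eq0.
move=> /convex_hull_cons[->|[k [x [k0 k1 tx ->]]]]
       /convex_hull_cons[->|[l [y [l0 l1 ty ->]]]] //.
- move=> /addrI e vb; exfalso; exact/vb/esym.
- by move=> /addIr e va; case: va.
move=> e _.
have d0 : 0 < 2 - k - l by lra.
have -> : v = ((1 - k) / (2 - k - l)) *: x + (1 - (1 - k) / (2 - k - l)) *: y.
  have {}e : (2 - k - l) *: v = (1 - k) *: x + (1 - l) *: y.
    apply: (addrI (k *: v + l *: v)).
    rewrite addrACA e -scalerDl -scalerDl (_ : k + l + _ = 2); last by ring.
    by rewrite scaler_nat mulr2n.
  apply: (scalerI (lt0r_neq0 d0)); rewrite e scalerDr !scalerA.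
  by congr (_ *: _ + _ *: _); field; rewrite lt0r_neq0.
apply: convex_hull_convex => //.
  by rewrite divr_ge0 ?ltW //; lra.
by rewrite ler_pdivrMr //; lra.
Qed.

(** The points [a] and [b] range over all of [s], not only over [t], because the cross terms to be
    excluded later may involve any exponents. The induction is on a bound [k] for the size of a
    sublist with the same hull. *)
Lemma convex_hull_extreme s : exists t,
  [/\ {subset t <= s}, forall x, x \in s -> convex_hull t x
    & forall v a b, v \in t -> a \in s -> b \in s -> a + b = v + v -> a = b].
Proof.
suff H k t : (size t <= k)%N -> {subset t <= s} ->
    (forall x, x \in s -> convex_hull t x) -> exists t',
  [/\ {subset t' <= s}, forall x, x \in s -> convex_hull t' x
    & forall v a b, v \in t' -> a \in s -> b \in s -> a + b = v + v -> a = b].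
  by apply: (H (size s) s) => // x; exact: mem_convex_hull.
elim: k t => [|k IH] t.
  by rewrite leqn0 => /nilP -> ts hs; exists [::]; split.
move=> tk ts hs.
pose ext v := all (fun a => all (fun b => (a + b == v + v) ==> (a == b)) s) s.
have [/allP te|/allPn[v vt]] := boolP (all ext t).
  exists t; split=> // v a b vt sa sb /eqP e.
  by have /allP/(_ _ sa)/allP/(_ _ sb) := te v vt; rewrite e => /eqP.
move=> /allPn[a sa /allPn[b sb]]; rewrite negb_imply => /andP[/eqP e /eqP ab].
have sub x : x \in t -> convex_hull (v :: rem v t) x.
  by rewrite (perm_mem (perm_to_rem vt)); exact: mem_convex_hull.
have hs' x : x \in s -> convex_hull (v :: rem v t) x.
  by move=> /hs; apply: convex_hull_min => //; exact: convex_hull_convex.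
(* Although [a] and [b] need not belong to [t], they lie in its hull, so [v] is redundant and can be
   removed. *)
have vr := midpoint_convex_hull (hs' _ sa) (hs' _ sb) e ab.
apply: (IH (rem v t)).
- by rewrite size_rem //; case: (size t) tk.
- by move=> x /mem_rem /ts.
- move=> x /hs'; apply: convex_hull_min; first exact: convex_hull_convex.
  by move=> y; rewrite inE => /orP[/eqP -> //|]; exact: mem_convex_hull.
Qed.

End ConvexHull.

Section SquareCoefficients.
Variables (R : realDomainType) (n : nat).
Implicit Types (q : {mpoly R[n]}) (m : 'X_{1..n}).

(** The coefficient is a sum of products of coefficients at [a] and [b] with [a + b = m]. Each
    product is zero off the support and a square on it. *)
Lemma mcoeff_sqr_ge0 q m :
  (forall a b, a \in msupp q -> b \in msupp q -> (a + b)%MM = m -> a = b) ->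
  0 <= (q ^+ 2)@_m.
Proof.
move=> diag; rewrite expr2 mcoeffM; apply: sumr_ge0 => -[a b] /= /eqP e.
have [qa|] := boolP (bmnm a \in msupp q); last first.
  by rewrite -mcoeff_eq0 => /eqP ->; rewrite mul0r.
have [qb|] := boolP (bmnm b \in msupp q); last first.
  by rewrite -mcoeff_eq0 => /eqP ->; rewrite mulr0.
by rewrite (diag _ _ qa qb (esym e)) -expr2 sqr_ge0.
Qed.

(** Nonnegativity being known, only nonvanishing remains: the pair [(m, m)] gives a nonzero square,
    and any other contributing pair would have [a = b], hence [a = m] by halving. *)
Lemma mcoeff_sqr_gt0 q m : m \in msupp q ->
  (forall a b, a \in msupp q -> b \in msupp q -> (a + b)%MM = (m + m)%MM ->
     a = b) ->
  0 < (q ^+ 2)@_(m + m).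
Proof.
move=> qm diag; rewrite lt_def mcoeff_sqr_ge0 // andbT.
rewrite expr2 mcoeffM.
(* The convolution formula [mcoeffM] runs over exponents of bounded degree, so [m] must be packaged
   with this bound. *)
have mlt : (mdeg m < (mdeg (m + m)).+1)%N by rewrite mdegD ltnS leq_addr.
rewrite (bigD1 (BMultinom mlt, BMultinom mlt)) //= big1 ?addr0.
  by rewrite mulf_neq0 // -mcoeff_msupp.
move=> -[a b] /= /andP[/eqP e ne].
have [qa|] := boolP (bmnm a \in msupp q); last first.
  by rewrite -mcoeff_eq0 => /eqP ->; rewrite mul0r.
have [qb|] := boolP (bmnm b \in msupp q); last first.
  by rewrite -mcoeff_eq0 => /eqP ->; rewrite mulr0.
have ab := diag _ _ qa qb (esym e).
have am : bmnm a = m.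
  apply/mnmP => i; have /mnmP/(_ i) := e; rewrite !mnmDE ab !addnn.
  by move/double_inj.
by case/eqP: ne; congr pair; apply: val_inj => //=; rewrite -ab.
Qed.

End SquareCoefficients.

Section NewtonPolytope.
Variables (R : realType) (n : nat).
Implicit Types (P : {mpoly R[n]}) (m a b : 'X_{1..n}).

Lemma exponent_pointD a b :
  exponent_point R (a + b)%MM = exponent_point R a + exponent_point R b.
Proof. by apply/rowP => i; rewrite !mxE mnmDE natrD. Qed.

Lemma exponent_point_inj : injective (@exponent_point R n).
Proof.
move=> a b /rowP e; apply/mnmP => i; have := e i; rewrite !mxE.
by move/eqP; rewrite eqr_nat => /eqP.
Qed.

Lemma lattice_exponent_point m : lattice_point (exponent_point R m).
Proof. by move=> i; rewrite mxE natr_int. Qed.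

Lemma half_newton_polytope_convex P : convex_set (half_newton_polytope P).
Proof.
move=> _ _ l l0 l1 [x hx <-] [y hy <-].
exists (l *: x + (1 - l) *: y); first exact: convex_hull_convex.
by rewrite scalerDr !scalerA ![2^-1 * _]mulrC.
Qed.

Lemma half_newton_polytope_double P m : (m + m)%MM \in msupp P ->
  half_newton_polytope P (exponent_point R m).
Proof.
move=> Pm; exists (exponent_point R (m + m)%MM).
  by apply: mem_convex_hull; apply: map_f.
rewrite exponent_pointD -mulr2n -scaler_nat scalerA mulVf ?scale1r //.
by rewrite pnatr_eq0.
Qed.

Lemma msupp_sqr_half_newton_polytope (s : seq {mpoly R[n]}) q m :
  q \in s -> m \in msupp q ->
  half_newton_polytope (\sum_(r <- s) r ^+ 2) (exponent_point R m).
Proof.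
move=> sq qm; set P := \sum_(r <- s) _.
pose S := [seq exponent_point R a | r <- s, a <- msupp r].
have memS r a : r \in s -> a \in msupp r -> exponent_point R a \in S.
  by move=> sr ra; apply/allpairsPdep; exists r, a.
have [t [tS St ext]] := convex_hull_extreme S.
apply: (convex_hull_min (@half_newton_polytope_convex P) _
  (St _ (memS _ _ sq qm))).
move=> v vt; have /allpairsPdep[r [a [sr ra ev]]] := tS _ vt.
(* Extremality of [v] is needed for every [q'] in [s], not just for [r]: the other squares must not
   cancel the positive contribution of [r] at [a + a]. *)
have diag q' : q' \in s -> forall b c, b \in msupp q' -> c \in msupp q' ->
    (b + c)%MM = (a + a)%MM -> b = c.
  move=> sq' b c qb qc e; apply: exponent_point_inj.
  apply: (ext v) => //; try exact: memS sq' _.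
  by rewrite ev -!exponent_pointD e.
rewrite ev; apply: half_newton_polytope_double.
rewrite mcoeff_msupp raddf_sum /= (big_rem r) //= gt_eqF // ltr_wpDr //.
  rewrite big_seq sumr_ge0 // => q' /mem_rem sq'.
  exact/mcoeff_sqr_ge0/diag.
exact/mcoeff_sqr_gt0/diag.
Qed.

End NewtonPolytope.

Theorem corollary4p9 (R : realType) (n : nat) (P : {mpoly R[n]})
  (p : 'X_{1..n}) (neg_coeff : P@_p < 0)
  (not_sum : ~ exists x y : 'rV[R]_n,
     [/\ x <> y,
         lattice_point x /\ half_newton_polytope P x,
         lattice_point y /\ half_newton_polytope P y
       & exponent_point R p = x + y]) :
  ~ sum_of_squares P.
Proof.
move=> [s Ps]; move: neg_coeff; apply/negP; rewrite -leNgt.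
rewrite Ps raddf_sum /= big_seq sumr_ge0 // => q sq.
(* Exponents [a <> b] in one [q] with sum [p] would be exactly the pair of lattice points that
   [not_sum] forbids. *)
apply: mcoeff_sqr_ge0 => a b qa qb e; apply/eqP/negPn/negP => /eqP ab.
apply: not_sum; exists (exponent_point R a), (exponent_point R b); split.
- by move=> /exponent_point_inj.
- split; first exact: lattice_exponent_point.
  by rewrite Ps; exact: msupp_sqr_half_newton_polytope qa.
- split; first exact: lattice_exponent_point.
  by rewrite Ps; exact: msupp_sqr_half_newton_polytope qb.
- by rewrite -e exponent_pointD.
Qed.
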